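(* Let $m\ge1$ be an integer and $\delta>-m$. Let $\rho_{m,\delta}$ be the unique root in $(0,1)$ of $h(z)=2\left[1-\frac{m+\delta}{2m+\delta}z\right]^m-z-1$. Run the greedy matching algorithm on the preferential attachment process $\{G_{m,\delta}(t)\}$, let $X(t)$ be the number of vertices of $[t]$ not covered by the matching $M(t)$, and $x(t)=X(t)/t$. Then for any $\alpha<1/3$, almost surely $$\lim_{t\to\infty}t^{\alpha}\max\{0,x(t)-\rho_{m,\delta}\}=0.$$ In consequence, the greedy matching algorithm almost surely finds a sequence of nested matchings $\{M(t)\}$ with $M(t)$ of size at least $(1-o(1))(1-\rho_{m,\delta})t/2$ (i.e. the number of vertices covered by $M(t)$ is asymptotically at least $(1-\rho_{m,\delta})t$).
   Context: Preferential attachment process $\{G_{m,\delta}(t)\}_{t\ge1}$ (integer $m\ge1$, real $\delta\ge -m$): $G_{m,\delta}(1)$ is vertex $1$ with $m$ loops (a loop contributes $2$ to the degree). For $t\ge 1$, $G_{m,\delta}(t+1)$ is obtained by adding vertex $t+1$ and $m$ edges from it, one at a time: for $i=1,\dots,m$, with $d_{t,i-1}(x)$ the degree of $x$ just before the $i$-th edge of $t+1$ is added (so $d_{t,0}(t+1)=0$), the other endpoint $w$ of the $i$-th edge satisfies $\mathbb P(w=x)=\frac{d_{t,i-1}(x)+\delta}{(2m+\delta)t+2i-1+i\delta/m}$ for $x\in[t]$ and $\mathbb P(w=t+1)=\frac{d_{t,i-1}(t+1)+1+i\delta/m}{(2m+\delta)t+2i-1+i\delta/m}$ (a loop). Greedy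 matching algorithm: $M(1)=\emptyset$; given the matching $M(t)$ on $[t]$, if vertex $t+1$ attaches by one of its edges to some vertex $u\in[t]$ not covered by $M(t)$ (if there are several, one such $u$ is chosen arbitrarily), set $M(t+1)=M(t)\cup\{\{u,t+1\}\}$; otherwise $M(t+1)=M(t)$. *)

(* Defs.v *)
From mathcomp Require Export all_boot all_order all_algebra finmap.
From mathcomp Require Export all_classical all_reals all_analysis.

Set Implicit Arguments.
Unset Strict Implicit.
Unset Printing Implicit Defensive.

Export Order.TTheory GRing.Theory Num.Theory.
Export numFieldNormedType.Exports.

Local Open Scope classical_set_scope.
Local Open Scope ring_scope.

(* A multigraph on the positive integers is its list of edges; (v, v) is a
   loop and contributes 2 to the degree of v. *)
Definition multigraph := seq (nat * nat).

Definition deg (g : multigraph) (x : nat) : nat :=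
  (\sum_(a <- g) ((a.1 == x) + (a.2 == x)))%N.

(* [e s j] is the other endpoint of the j-th edge (1 <= j <= m) added with
   vertex s >= 1.  [pa_graph m e t k] is the graph on all edges added with
   vertices 1, ..., t together with the first k edges added with vertex t+1;
   in particular [pa_graph m e t 0] is G(t). *)
Definition pa_graph (m : nat) (e : nat -> nat -> nat) (t k : nat) : multigraph :=
  [seq (s, e s j) | s <- iota 1 t, j <- iota 1 m]
    ++ [seq (t.+1, e t.+1 j) | j <- iota 1 k].

(* Probability that the i-th edge of vertex t+1 ends at x, when g is the graph
   just before that edge is added. *)
Definition pa_prob (R : realType) (m : nat) (delta : R) (g : multigraph)
    (t i x : nat) : R :=
  let den := (2 * m%:R + delta) * t%:R + 2 * i%:R - 1 + i%:R * delta / m%:R in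
  if (1 <= x <= t)%N then ((deg g x)%:R + delta) / den
  else if x == t.+1 then ((deg g x)%:R + 1 + i%:R * delta / m%:R) / den
  else 0.

Definition filtration (d : measure_display) (T : measurableType d)
    (F : nat -> set (set T)) : Prop :=
  [/\ forall t, sigma_algebra setT (F t),
      forall t, F t `<=` measurable &
      forall s t, (s <= t)%N -> F s `<=` F t].

(* The preferential attachment process with parameters m and delta, relative to
   a filtration F: F t contains the information on the graphs up to time t, and
   possibly further (non-anticipating) information, such as the choices made by
   an algorithm run on the process.  The last clause says that, conditionally on
   F t and on the first i - 1 edges of vertex t+1, the other endpoint of the
   i-th edge has the law [pa_prob]; since the graph just before that edge is a
   discrete random variable, it is enough to condition on each of its values. *)
Definition pref_attachment (R : realType) (d : measure_display)
    (T : measurableType d) (P : probability T R) (m : nat) (delta : R)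
    (F : nat -> set (set T)) (W : nat -> nat -> T -> nat) : Prop :=
  let G t k w := pa_graph m (fun s j => W s j w) t k in
  [/\ filtration F,
      forall t s j n, (1 <= s <= t)%N -> (1 <= j <= m)%N ->
        F t [set w | W s j w = n],
      forall j w, (1 <= j <= m)%N -> W 1%N j w = 1%N &
      forall t i, (1 <= t)%N -> (1 <= i <= m)%N ->
        forall (A : set T) (g : multigraph) (x : nat), F t A ->
          P (A `&` [set w | G t i.-1 w = g] `&` [set w | W t.+1 i w = x])
          = (P (A `&` [set w | G t i.-1 w = g]) *
             (pa_prob m delta g t i x)%:E)%E].

Definition edge_set := {fset {fset nat}}.

Definition covered (M : edge_set) (v : nat) : bool :=
  has (fun a : {fset nat} => v \in a) (enum_fset M).

Definition is_matching (g : multigraph) (M : edge_set) : Prop :=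
  (forall a : {fset nat}, a \in M -> exists u v : nat,
     [/\ u != v, a = [fset u; v]%fset & ((u, v) \in g) || ((v, u) \in g)]) /\
  (forall a b : {fset nat}, a \in M -> b \in M -> a != b ->
     [disjoint a & b]%fset).

Definition candidate (m : nat) (e : nat -> nat -> nat) (t : nat) (M : edge_set)
    (u : nat) : bool :=
  [&& (1 <= u <= t)%N, ~~ covered M u & u \in [seq e t.+1 j | j <- iota 1 m]].

Definition greedy_step (m : nat) (e : nat -> nat -> nat) (t : nat)
    (M M' : edge_set) : Prop :=
  (exists2 u, candidate m e t M u & M' = ([fset u; t.+1] |` M)%fset) \/
  ((forall u, ~~ candidate m e t M u) /\ M' = M).

(* A run M of the greedy matching algorithm on the process W.  The choice among
   several candidates is unconstrained and may be randomized, but it is made at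
   time t+1, hence may not depend on later edges: M is adapted to F. *)
Definition greedy_matching (d : measure_display) (T : measurableType d)
    (m : nat) (F : nat -> set (set T)) (W : nat -> nat -> T -> nat)
    (M : nat -> T -> edge_set) : Prop :=
  [/\ forall t (S : edge_set), (1 <= t)%N -> F t [set w | M t w = S],
      forall w, M 1%N w = fset0 &
      forall w t, (1 <= t)%N ->
        greedy_step m (fun s j => W s j w) t (M t w) (M t.+1 w)].

Definition num_uncovered (M : edge_set) (t : nat) : nat :=
  count (fun v => ~~ covered M v) (iota 1 t).

Definition num_covered (M : edge_set) (t : nat) : nat :=
  count (covered M) (iota 1 t).

Definition h (R : realType) (m : nat) (delta z : R) : R :=
  2 * (1 - (m%:R + delta) / (2 * m%:R + delta) * z) ^+ m - z - 1.

(* Main.v *)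
Require Import Defs.
From mathcomp Require Import measurable_realfun ring lra zify.

Set Implicit Arguments.
Unset Strict Implicit.
Unset Printing Implicit Defensive.

Local Open Scope classical_set_scope.
Local Open Scope ring_scope.

(** Every vertex has degree at least [m], so when a fraction [x] of the vertices
[1, ..., t] is uncovered, each edge of vertex [t+1] misses the uncovered set
with conditional probability at most
[1 - (m + delta) / (2m + delta) * x + O(1/t)].  If all [m] edges miss it, the
number of uncovered vertices grows by one; otherwise it drops by one.  Hence
the conditional drift of [x] is at most [(h x + O(1/t)) / (t + 1)].  As [h]
decreases with slope at most [-1], the excess [y = max 0 (x - rho)] satisfies
[E (y (t+1))^2 <= (1 - 2/(t+1)) E (y t)^2 + C/(t+1)^2], so that
[E (y t)^2 <= C/t].  For [alpha < 1/3] the sum over [k] of the expectations of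
[(k^(3 alpha) y (k^3))^2] is therefore finite, and [k^(3 alpha) y (k^3)] tends
to [0] almost surely.  Between [k^3] and [(k+1)^3] the excess grows by at most
[7/k], which is negligible against [k^(-3 alpha)]. *)

Section RealAnalysis.
Context {R : realType}.
Implicit Types (a b x : R) (k n : nat).

Lemma lerB_exprn n a b : 0 <= b -> b <= a -> a <= 1 ->
  a ^+ n - b ^+ n <= n%:R * (a - b).
Proof.
move=> b0 ba a1; rewrite subrXX mulrC ler_wpM2r ?subr_ge0 //.
have -> : n%:R = \sum_(i < n) (1 : R) by rewrite sumr_const card_ord.
by apply: ler_sum => i _; rewrite mulr_ile1 ?exprn_ge0 ?exprn_ile1; lra.
Qed.

Lemma powRN_decrement_ge x a : 0 < x -> 0 <= a ->
  a * (x + 1) `^ (- (a + 1)) <= x `^ (- a) - (x + 1) `^ (- a).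
Proof.
move=> x0 a0; have y0 : 0 < x + 1 by lra.
have logs : (x + 1)^-1 <= ln (x + 1) - ln x.
  have : ln (1 + - (x + 1)^-1) <= - (x + 1)^-1.
    by apply: le_ln1Dx; rewrite ltrN2 invf_lt1; lra.
  have -> : 1 + - (x + 1)^-1 = x / (x + 1) by field; lra.
  by rewrite ln_div ?posrE //; lra.
rewrite opprD powRD ?(gt_eqF y0) ?implybT // powR_inv1 ?(ltW y0) //.
have -> : x `^ (- a) = (x + 1) `^ (- a) * expR (a * (ln (x + 1) - ln x)).
  by rewrite /powR !gt_eqF // -expRD; congr expR; ring.
have := expR_ge1Dx (a * (ln (x + 1) - ln x)).
have : a * (x + 1)^-1 <= a * (ln (x + 1) - ln x) by rewrite ler_wpM2l.
move=> al e1; rewrite mulrCA -[X in _ - X]mulr1 -mulrBr.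
by rewrite ler_wpM2l ?powR_ge0 //; lra.
Qed.

Lemma series_riemannR_le a n : 1 < a ->
  series (riemannR a) n <= 1 + (a - 1)^-1.
Proof.
move=> a1; have c0 : 0 < a - 1 by lra.
case: n => [|n]; first by rewrite /series /= big_nil addr_ge0 ?invr_ge0 ?ltW.
apply: (@le_trans _ _ (1 + (a - 1)^-1 * (1 - n.+1%:R `^ (- (a - 1))))).
  elim: n => [|n IH].
    by rewrite /series /= big_nat1 /riemannR !powR1 invr1 subrr mulr0 addr0.
  rewrite seriesSr /riemannR -powRN; apply: le_trans (lerD IH (lexx _)) _.
  have := powRN_decrement_ge (ltr0Sn R n) (ltW c0).
  rewrite natr1 subrK mulrC -ler_pdivlMr // mulrC !mulrBr; lra.
by rewrite lerD2l ler_piMr ?invr_ge0 ?(ltW c0) // gerBl powR_ge0.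
Qed.

Lemma is_cvg_series_riemannR a : 1 < a -> cvgn (series (riemannR a)).
Proof.
move=> a1; apply: nondecreasing_is_cvgn.
  apply/nondecreasing_seqP => n.
  by rewrite seriesSr lerDl ltW // riemannR_gt0; lra.
by exists (1 + (a - 1)^-1) => _ [n _ <-]; exact: series_riemannR_le.
Qed.

Lemma cvg_natr_powRN a : 0 < a ->
  (fun n => n%:R `^ (- a) : R) @ \oo --> (0 : R).
Proof.
move=> a0; rewrite -cvg_shiftS.
have -> : [sequence n.+1%:R `^ (- a) : R]_n = (fun n => harmonic n `^ a).
  by apply/funext => n; rewrite /= -powR_inv1 // -powRrM mulN1r.
have /cvg_at_rightP := powR_cvg0 a0; apply; split; last exact: cvg_harmonic.
by move=> n; exact: harmonic_gt0.
Qed.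

Lemma cvg0_sqr {T : Type} (F : set_system T) {filterF : Filter F} (f : T -> R) :
  (fun z => f z ^+ 2) @ F --> (0 : R) -> f @ F --> (0 : R).
Proof.
move=> f2; apply/norm_cvg0P.
have := cvg_comp _ _ f2 (@sqrt_continuous R 0); rewrite sqrtr0.
suff -> : Num.sqrt \o (fun z => f z ^+ 2) = fun z => `|f z| by [].
by apply/funext => z; exact: sqrtr_sqr.
Qed.

Lemma inv_recursion_step (x C : R) : 1 <= x -> 0 <= C ->
  (1 - 2 / (x + 1)) * (C / x) + C / (x + 1) ^+ 2 <= C / (x + 1).
Proof.
move=> x1 C0.
have -> : (1 - 2 / (x + 1)) * (C / x) + C / (x + 1) ^+ 2 =
   C / (x + 1) - C / (x * (x + 1) ^+ 2) by field; lra.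
by rewrite gerBl divr_ge0 // mulr_ge0 ?sqr_ge0 //; lra.
Qed.

Lemma ratio_nat_itv n t : (n <= t)%N -> 0 <= (n%:R / t%:R : R) <= 1.
Proof.
case: t => [|t] nt; first by rewrite invr0 mulr0 lexx ler01.
by rewrite divr_ge0 // ler_pdivrMr ?ltr0n // mul1r ler_nat.
Qed.

End RealAnalysis.

Section Lacunary.
Context {R : realType}.
Implicit Types (alpha c s u : R) (k n t : nat).

Definition rootn n t : nat := \max_(k < t.+1 | (k ^ n <= t)%N) k.

Lemma leq_rootn n k t : (0 < n)%N -> (k <= rootn n t)%N = (k ^ n <= t)%N.
Proof.
move=> n0; apply/idP/idP => [kr|kt].
  apply: (@leq_trans (rootn n t ^ n)); first by rewrite leq_exp2r.
  rewrite /rootn; elim/big_ind: _ => [|i j it jt|//]; first by rewrite exp0n.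
  by rewrite /maxn; case: ifP.
have k_lt_t1 : (k < t.+1)%N.
  rewrite ltnS; apply: leq_trans kt; case: k => // k.
  by rewrite -(prednK n0) expnS leq_pmulr // expn_gt0.
by rewrite (@leq_bigmax_cond _ _ _ (Ordinal k_lt_t1)).
Qed.

Lemma rootn_itv n t : (0 < n)%N ->
  (rootn n t ^ n <= t)%N && (t < (rootn n t).+1 ^ n)%N.
Proof. by move=> n0; rewrite -leq_rootn // ltnNge -leq_rootn // leqnn ltnn. Qed.

Lemma cvg_rootn n : (0 < n)%N -> rootn n @ \oo --> \oo.
Proof.
move=> n0; apply/cvgnyPge => k; exists (k ^ n)%N => // t /= kt.
by rewrite leq_rootn.
Qed.

Lemma powR_le_dilate alpha c s u :
  0 < s -> 1 <= c -> s <= u -> u <= c * s -> alpha <= 1 ->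
  u `^ alpha <= c * s `^ alpha.
Proof.
move=> s0 c1 su ucs alpha1; have [alpha0|alpha0] := leP 0 alpha.
  apply: (@le_trans _ _ ((c * s) `^ alpha)).
    by apply: ge0_ler_powR; rewrite ?nnegrE //; lra.
  rewrite powRM; [|lra|lra].
  by rewrite ler_wpM2r ?powR_ge0 // ler1_powR.
apply: (@le_trans _ _ (s `^ alpha)); last first.
  by rewrite ler_peMl ?powR_ge0.
have u0 : 0 < u by exact: lt_le_trans su.
rewrite -[alpha]opprK (powRN u) (powRN s) lef_pV2 ?posrE ?powR_gt0 //.
by apply: ge0_ler_powR; rewrite ?nnegrE; lra.
Qed.

Lemma cube_gap_le k t : (1 <= k)%N -> (k ^ 3 <= t)%N -> (t < k.+1 ^ 3)%N ->
  (t - k ^ 3)%:R / (k ^ 3)%:R <= 7 / k%:R :> R.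
Proof.
move=> k_gt0 kt tk; have k0 : (0 < k ^ 3)%N by rewrite expn_gt0 k_gt0.
rewrite ler_pdivrMr ?ltr0n // mulrAC ler_pdivlMr ?ltr0n //.
rewrite -!natrM ler_nat; move: k0 kt tk; rewrite !expnS !expn0; nia.
Qed.

Lemma cvg_cube_interpolation alpha c (y : nat -> R) :
    alpha < 1 / 3 -> (forall n, 0 <= y n) ->
    (forall k n, (1 <= k)%N -> (k ^ 3 <= n)%N -> (n < k.+1 ^ 3)%N ->
      y n <= y (k ^ 3)%N + c / k%:R) ->
    (fun k => k%:R `^ (3 * alpha) * y (k ^ 3)%N) @ \oo --> (0 : R) ->
  (fun n => n%:R `^ alpha * y n) @ \oo --> (0 : R).
Proof.
move=> alpha_lt y0 gap cubes0.
pose bound k : R := 8 * (k%:R `^ (3 * alpha) * y (k ^ 3)%N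
  + c * k%:R `^ (- (1 - 3 * alpha))).
have bound0 : bound k @[k --> \oo] --> (0 : R).
  rewrite -(mulr0 8) -(addr0 0) -[in X in _ + X](mulr0 c).
  apply: cvgM; first exact: cvg_cst.
  apply: cvgD => //; apply: cvgM; first exact: cvg_cst.
  by apply: cvg_natr_powRN; lra.
apply: (squeeze_cvgr _ (cvg_cst 0)
  (cvg_comp _ _ (cvg_rootn (ltn0Sn 2)) bound0)).
exists 1%N => // n /= n1; rewrite mulr_ge0 ?powR_ge0 //=.
have /andP[kn nk] := rootn_itv n (ltn0Sn 2).
set k := rootn 3 n in kn nk *.
have k_gt0 : (1 <= k)%N by rewrite leq_rootn.
have k_ge1 : 1 <= k%:R :> R by rewrite ler1n.
have n_pow : n%:R `^ alpha <= 8 * k%:R `^ (3 * alpha).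
  rewrite powRrM powR_mulrn // -natrX; apply: powR_le_dilate; try lra.
  - by rewrite ltr0n expn_gt0 k_gt0.
  - by rewrite ler_nat.
  by rewrite -natrM ler_nat; move: k_gt0 nk; rewrite !expnS !expn0; nia.
apply: (@le_trans _ _ (8 * k%:R `^ (3 * alpha) * (y (k ^ 3)%N + c / k%:R))).
  by apply: ler_pM; rewrite ?powR_ge0 //; exact: gap.
rewrite /bound -mulrA ler_pM2l // mulrDr lerD2l mulrCA opprB powRD.
  by rewrite powR_inv1.
by rewrite pnatr_eq0 -lt0n k_gt0 implybT.
Qed.

End Lacunary.

Section DiscreteRandomVariables.
Context {R : realType} {d : measure_display} {T : measurableType d}.

Definition measurable_fibers {U : Type} (f : T -> U) :=
  forall y, measurable [set w | f w = y].

Lemma measurable_fibers_preimage (U : countType) (f : T -> U) (B : set U) :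
  measurable_fibers f -> measurable (f @^-1` B).
Proof.
move=> mf; have -> : f @^-1` B = \bigcup_(y in B) [set w | f w = y].
  apply/seteqP; split=> [w Bw|w [y By /= fwy]]; first by exists (f w).
  by rewrite -fwy in By.
rewrite bigcup_mkcond; apply: countable_bigcupT_measurable => [|y].
  exact: countableP.
by case: ifP.
Qed.

Lemma measurable_fibers_map (I : eqType) (U : Type) (f : I -> T -> U)
    (s : seq I) :
  (forall i, i \in s -> measurable_fibers (f i)) ->
  measurable_fibers (fun w => [seq f i w | i <- s]).
Proof.
elim: s => [|i s IH] mf [|y l] /=.
- by rewrite (_ : mkset _ = setT) //; apply/seteqP; split.
- by rewrite (_ : mkset _ = set0) //; apply/seteqP; split.
- by rewrite (_ : mkset _ = set0) //; apply/seteqP; split.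
have -> : [set w | f i w :: [seq f j w | j <- s] = y :: l] =
    [set w | f i w = y] `&` [set w | [seq f j w | j <- s] = l].
  by apply/seteqP; split=> w /= [-> ->].
apply: measurableI; first by apply: mf; rewrite mem_head.
by apply: IH => j js; apply: mf; rewrite in_cons js orbT.
Qed.

Lemma measurable_fun_fibers d' (V : measurableType d') (U : countType)
    (f : T -> U) (g : U -> V) :
  measurable_fibers f -> measurable_fun setT (g \o f).
Proof.
move=> mf _ Y _; rewrite setTI.
exact: (measurable_fibers_preimage (g @^-1` Y) mf).
Qed.

(* [ge0_integral_bigcup] needs a partition indexed by [nat]. *)
Definition nth_fiber (U : countType) (f : T -> U) (n : nat) : set T :=
  [set w | choice.pickle_inv n = Some (f w)].

Lemma bigcup_nth_fiber (U : countType) (f : T -> U) :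
  \bigcup_n nth_fiber f n = setT.
Proof.
apply/seteqP; split=> // w _; exists (choice.pickle (f w)) => //.
by rewrite /nth_fiber /= choice.pickleK_inv.
Qed.

Lemma trivIset_nth_fiber (U : countType) (f : T -> U) :
  trivIset setT (nth_fiber f).
Proof.
move=> i j _ _ [w [wi wj]].
have pickle_fiber n : nth_fiber f n w -> choice.pickle (f w) = n.
  by rewrite /nth_fiber /= => wn; have := @choice.pickle_invK U n; rewrite wn.
by rewrite -(pickle_fiber i wi) (pickle_fiber j wj).
Qed.

Lemma nth_fiber_cases (U : countType) (f : T -> U) n :
  nth_fiber f n = set0 \/ exists y, nth_fiber f n = [set w | f w = y].
Proof.
rewrite /nth_fiber; case: (choice.pickle_inv n) => [y|]; [right|left].
  by exists y; apply/seteqP; split=> w /= [->].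
by apply/seteqP; split.
Qed.

Lemma ge0_le_integral_fibers (mu : {measure set T -> \bar R}) (U : countType)
    (f : T -> U) (g1 g2 : T -> \bar R) :
  measurable_fibers f ->
  measurable_fun setT g1 -> measurable_fun setT g2 ->
  (forall w, 0 <= g1 w)%E -> (forall w, 0 <= g2 w)%E ->
  (forall y, \int[mu]_(w in [set w | f w = y]) g1 w <=
             \int[mu]_(w in [set w | f w = y]) g2 w)%E ->
  (\int[mu]_w g1 w <= \int[mu]_w g2 w)%E.
Proof.
move=> mf mg1 mg2 g1_ge0 g2_ge0 le_fibers; rewrite -(bigcup_nth_fiber f).
have m_nth n : measurable (nth_fiber f n).
  by case: (nth_fiber_cases f n) => [->|[y ->]].
have triv := @trivIset_nth_fiber U f.
rewrite !ge0_integral_bigcup ?bigcup_nth_fiber //.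
apply: lee_nneseries => [n _ _|n _]; first exact: integral_ge0.
by case: (nth_fiber_cases f n) => [->|[y ->]]; rewrite ?integral_set0.
Qed.

Lemma le_measure_fibers (mu : {measure set T -> \bar R}) (U : countType)
    (f : T -> U) (A B : set T) (c : R) :
  measurable_fibers f -> measurable A -> measurable B -> 0 <= c ->
  (forall y, mu (A `&` [set w | f w = y]) <=
             c%:E * mu (B `&` [set w | f w = y]))%E ->
  (mu A <= c%:E * mu B)%E.
Proof.
move=> mf mA mB c0 le_fibers.
have mind C D : measurable C -> measurable_fun D (fun w : T => (\1_C w : R)%:E).
  by move=> mC; apply/measurable_EFinP; exact: measurable_indic.
have int_c D : measurable D ->
    (\int[mu]_(w in D) (c%:E * (\1_B w)%:E) = c%:E * mu (B `&` D))%E.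
  by move=> mD; rewrite ge0_integralZl ?lee_fin ?integral_indic //; exact: mind.
rewrite -(setIT A) -(setIT B) -integral_indic // -int_c //.
apply: (ge0_le_integral_fibers mf); first exact: mind.
- by apply: emeasurable_funM => //; exact: mind.
- by move=> w; rewrite lee_fin.
- by move=> w; rewrite mule_ge0 ?lee_fin.
- by move=> y; rewrite int_c // integral_indic.
Qed.

End DiscreteRandomVariables.

Section IntegralBounds.
Context {R : realType} {d : measure_display} {T : measurableType d}.

Lemma ge0_integral_affine (P : probability T R) (f : T -> R) (a b : R) :
  measurable_fun setT f -> (forall w, 0 <= f w) -> 0 <= a -> 0 <= b ->
  (\int[P]_w (a * f w + b)%:E = a%:E * \int[P]_w (f w)%:E + b%:E)%E.
Proof.
move=> mf f0 a0 b0; have mEf : measurable_fun setT (EFin \o f).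
  exact/measurable_EFinP.
under eq_integral do rewrite EFinD EFinM.
rewrite ge0_integralD //; last 2 first.
- by move=> w _; rewrite -EFinM lee_fin mulr_ge0.
- exact: emeasurable_funM.
rewrite integral_cst // [X in (_ + _ * X)%E]probability_setT mule1.
by rewrite ge0_integralZl ?lee_fin // => w _; rewrite lee_fin.
Qed.

Lemma ge0_integral_le_two_values (mu : {finite_measure set T -> \bar R})
    (A N : set T) (f : T -> R) (a b p : R) :
  measurable A -> measurable N -> measurable_fun A f ->
  (forall w, 0 <= f w) -> 0 <= b -> b <= a ->
  (forall w, A w -> N w -> f w <= a) -> (forall w, A w -> ~ N w -> f w <= b) ->
  (mu (A `&` N) <= p%:E * mu A)%E ->
  (\int[mu]_(w in A) (f w)%:E <= (p * a + (1 - p) * b)%:E * mu A)%E.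
Proof.
move=> mA mN mf f0 b0 ba fa fb muN.
have mind : measurable_fun A (fun w => (\1_N w : R)%:E).
  by apply/measurable_EFinP; exact: measurable_indic.
apply: (@le_trans _ _ (\int[mu]_(w in A) (b%:E + (a - b)%:E * (\1_N w)%:E))%E).
  apply: ge0_le_integral => //.
  - by move=> w _; rewrite lee_fin.
  - exact/measurable_EFinP.
  - by apply: emeasurable_funD => //; exact: emeasurable_funM.
  move=> w Aw; rewrite -EFinM -EFinD lee_fin indicE.
  have [Nw|Nw] := pselect (N w).
    by rewrite mem_set // mulr1 addrC subrK; exact: fa.
  by rewrite memNset // mulr0 addr0; exact: fb.
rewrite ge0_integralD //; last 2 first.
- by move=> w _; rewrite -EFinM lee_fin mulr_ge0 ?subr_ge0.
- exact: emeasurable_funM.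
rewrite integral_cst // ge0_integralZl ?lee_fin ?subr_ge0 //.
rewrite integral_indic // setIC.
have muA : mu A \is a fin_num by exact: fin_num_measure.
apply: (@le_trans _ _ (b%:E * mu A + (a - b)%:E * (p%:E * mu A))%E).
  by apply: leeD2l; apply: lee_wpmul2l => //; rewrite lee_fin subr_ge0.
rewrite -(fineK muA) -!EFinM -EFinD lee_fin le_eqVlt; apply/orP; left.
by apply/eqP; ring.
Qed.

Lemma ae_cvg0_summable (mu : {measure set T -> \bar R}) (f : nat -> T -> R) :
  (forall k, measurable_fun setT (f k)) -> (forall k w, 0 <= f k w) ->
  (\sum_(0 <= k <oo) \int[mu]_w (f k w)%:E < +oo)%E ->
  {ae mu, forall w, f^~ w @ \oo --> (0 : R)}.
Proof.
move=> mf f0 sum_fin.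
have mEf k : measurable_fun setT (EFin \o f k) by exact/measurable_EFinP.
pose S w := (\sum_(0 <= k <oo) (f k w)%:E)%E.
have S0 w : (0 <= S w)%E by apply: nneseries_ge0 => k _ _; rewrite lee_fin.
have intS : mu.-integrable setT S.
  apply/integrableP; split.
    apply: ge0_emeasurable_sum => [k w _ _|k _]; last exact: mEf.
    by rewrite lee_fin.
  under eq_integral do rewrite gee0_abs //.
  by rewrite integral_nneseries // => k w _; rewrite lee_fin.
have := integrable_ae measurableT intS; apply: filterS => w /(_ Logic.I) Sw.
apply: cvg_series_cvg_0; apply: nnseries_is_cvg => //.
by rewrite ltey_eq Sw.
Qed.

Lemma nneseries_lt_pinfty (u : nat -> R) :
  cvgn (series u) -> (\sum_(0 <= k <oo) (u k)%:E < +oo)%E.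
Proof.
move=> cu; rewrite (_ : (fun n => _) = EFin \o series u); last first.
  by apply/funext => n /=; rewrite sumEFin.
by rewrite EFin_lim // ltry.
Qed.

End IntegralBounds.

Section Excess.
Context {R : realType}.
Implicit Types rho x p i B : R.

Definition excess rho x : R := Num.max 0 (x - rho).

Lemma excess_ge0 rho x : 0 <= excess rho x.
Proof. by rewrite /excess le_max lexx. Qed.

Lemma excess_ge rho x : x - rho <= excess rho x.
Proof. by rewrite /excess le_max lexx orbT. Qed.

Lemma excess_homo rho : {homo excess rho : x y / x <= y}.
Proof.
by move=> x y xy; rewrite ge_max excess_ge0 (le_trans _ (excess_ge _ _)) ?lerB.
Qed.

Lemma excess_addr_le rho x y : 0 <= y -> excess rho (x + y) <= excess rho x + y.
Proof.
move=> y0; rewrite ge_max addr_ge0 ?excess_ge0 //=.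
by rewrite addrAC lerD2r excess_ge.
Qed.

Lemma excess_le0 rho x : x <= rho -> excess rho x = 0.
Proof. by rewrite -subr_le0 => /max_idPl. Qed.

Lemma excess_id rho x : rho <= x -> excess rho x = x - rho.
Proof. by rewrite -subr_ge0 => /max_idPr. Qed.

Lemma sqr_excess_le rho x : excess rho x ^+ 2 <= (x - rho) ^+ 2.
Proof.
have [xr|rx] := leP x rho; first by rewrite excess_le0 // expr0n sqr_ge0.
by rewrite excess_id // ltW.
Qed.

(* When [x] is the fraction of uncovered vertices after [i^-1 - 1] steps, the
   next fraction is [x + (1 - x) * i] or [x - (1 + x) * i], according as the
   number of uncovered vertices goes up or down by one. *)
Lemma sqr_excess_step_le rho x p i B :
    0 <= rho -> 0 <= x <= 1 -> 0 <= p <= 1 -> 0 <= i -> 0 <= B ->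
    (rho <= x -> 2 * p - 1 - x <= rho - x + B * i) ->
  p * excess rho (x + (1 - x) * i) ^+ 2
    + (1 - p) * excess rho (x - (1 + x) * i) ^+ 2
  <= (1 - 2 * i) * excess rho x ^+ 2 + (2 * B + 4) * i ^+ 2.
Proof.
move=> r0 /andP[x0 x1] /andP[p0 p1] i0 B0 drift.
have i2_ge0 : 0 <= i ^+ 2 := sqr_ge0 i.
have Bi2_ge0 : 0 <= B * i ^+ 2 by rewrite mulr_ge0.
have [xr|rx] := leP x rho.
  have up : excess rho (x + (1 - x) * i) ^+ 2 <= i ^+ 2.
    rewrite lerXn2r ?nnegrE ?excess_ge0 // ge_max i0 /=; nra.
  rewrite [in X in _ + X]excess_le0; last by nra.
  rewrite (excess_le0 xr) expr0n /= !mulr0 addr0 add0r.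
  apply: le_trans (ler_wpM2l p0 up) _; nra.
have up := ler_wpM2l p0 (sqr_excess_le rho (x + (1 - x) * i)).
have onem_ge0 : 0 <= 1 - p by lra.
have down := ler_wpM2l onem_ge0 (sqr_excess_le rho (x - (1 + x) * i)).
rewrite (excess_id (ltW rx)).
apply: le_trans (lerD up down) _.
have -> : p * (x + (1 - x) * i - rho) ^+ 2
    + (1 - p) * (x - (1 + x) * i - rho) ^+ 2 =
    (x - rho) ^+ 2 + 2 * ((x - rho) * i) * (2 * p - 1 - x)
    + (p * (1 - x) ^+ 2 + (1 - p) * (1 + x) ^+ 2) * i ^+ 2 by ring.
have first_order : (x - rho) * i * (2 * p - 1 - x) <=
    (x - rho) * i * (rho - x + B * i).
  by apply: ler_wpM2l (drift (ltW rx)); rewrite mulr_ge0 // subr_ge0 ltW.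
have second_order : (p * (1 - x) ^+ 2 + (1 - p) * (1 + x) ^+ 2) * i ^+ 2 <=
    4 * i ^+ 2.
  apply: ler_wpM2r => //.
  have : (1 - x) ^+ 2 <= 4 by nra.
  have : (1 + x) ^+ 2 <= 4 by nra.
  nra.
have : (x - rho) * (B * i ^+ 2) <= B * i ^+ 2 by rewrite ler_piMl //; lra.
move: first_order second_order; rewrite !expr2; lra.
Qed.

End Excess.

Section DriftFunction.
Context {R : realType}.
Variables (m : nat) (delta : R).
Hypotheses (m_ge1 : (1 <= m)%N) (delta_gt : - m%:R < delta).
Implicit Types (x y rho : R) (t n : nat).

(* Each proof below copies these facts, because [lra] ignores the hypotheses of
   the section. *)
Let mR_ge1 : 1 <= m%:R :> R. Proof. by rewrite ler1n. Qed.

Let mdelta_gt0 : 0 < m%:R + delta. Proof. by rewrite -ltrBlDl sub0r. Qed.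

Definition attach_ratio : R := (m%:R + delta) / (2 * m%:R + delta).

Lemma attach_ratio_itv : 0 < attach_ratio < 1.
Proof.
have [one_le_m md_gt0] := (mR_ge1, mdelta_gt0).
by rewrite /attach_ratio divr_gt0 ?ltr_pdivrMr /=; lra.
Qed.

Lemma h_attach_ratioE x : h m delta x = 2 * (1 - attach_ratio * x) ^+ m - x - 1.
Proof. by []. Qed.

Lemma h_slope_le x y : 0 <= x -> x <= y -> y <= 1 ->
  h m delta y - h m delta x <= x - y.
Proof.
move=> x0 xy y1; have /andP[c0 c1] := attach_ratio_itv.
rewrite !h_attach_ratioE.
suff : (1 - attach_ratio * y) ^+ m <= (1 - attach_ratio * x) ^+ m by lra.
by rewrite lerXn2r ?nnegrE; nra.
Qed.

Lemma continuous_h : continuous (h m delta).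
Proof.
move=> x; apply: cvgB; last exact: cvg_cst.
apply: cvgB; last exact: cvg_id.
apply: cvgM; first exact: cvg_cst.
apply: (@continuous_comp _ _ _ (fun z : R => 1 - attach_ratio * z)
  (fun z : R => z ^+ m)); last exact: exprn_continuous.
by apply: cvgB; [|apply: cvgM]; do ?[exact: cvg_cst|exact: cvg_id].
Qed.

Lemma h_unique_root :
  exists rho, unique (fun z : R => 0 < z < 1 /\ h m delta z = 0) rho.
Proof.
have /andP[c0 c1] := attach_ratio_itv.
have h0 : h m delta 0 = 1 by rewrite h_attach_ratioE mulr0 !subr0 expr1n; lra.
have h1 : h m delta 1 < 0.
  rewrite h_attach_ratioE mulr1; suff : (1 - attach_ratio) ^+ m < 1 by lra.
  by rewrite exprn_ilt1 -?lt0n //; lra.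
have [||rho] := @IVT R (h m delta) 0 1 0 ler01.
- by apply: continuous_subspaceT; exact: continuous_h.
- by rewrite h0 ge_min le_max (ltW h1) orbT ler01.
rewrite in_itv /= => /andP[rho_ge0 rho_le1] hrho; exists rho; split.
  split=> //; rewrite !lt_neqAle rho_ge0 rho_le1 !andbT; apply/andP; split.
    by apply/eqP => rho0; move: hrho h0; rewrite -rho0 => ->; lra.
  by apply/eqP => rho1; move: hrho h1; rewrite rho1 => ->; lra.
move=> z [/andP[z0 z1] hz].
have [zr|rz] := leP z rho.
  by have := h_slope_le (ltW z0) zr rho_le1; lra.
by have := h_slope_le rho_ge0 (ltW rz) (ltW z1); lra.
Qed.

(* A lower bound, valid for all [m] edges of vertex [t+1], for the probability
   of attaching to a given earlier vertex, whose degree is at least [m]. *)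
Definition attach_min t : R :=
  (m%:R + delta) / ((2 * m%:R + delta) * t%:R + (2 * m%:R + `|delta|)).

Definition edge_miss_bound t n : R := 1 - n%:R * attach_min t.

Definition vertex_miss_bound t n : R := edge_miss_bound t n ^+ m.

Definition attach_error : R := (2 * m%:R + `|delta|) / (2 * m%:R + delta).

Lemma attach_error_ge0 : 0 <= attach_error.
Proof.
have [one_le_m md_gt0] := (mR_ge1, mdelta_gt0).
by have normd_ge0 := normr_ge0 delta; rewrite divr_ge0 //; lra.
Qed.

Lemma edge_miss_bound_itv t n : (n <= t)%N -> 0 <= edge_miss_bound t n <= 1.
Proof.
move=> nt; have [one_le_m md_gt0] := (mR_ge1, mdelta_gt0).
have normd_ge0 := normr_ge0 delta.
have n_le_t : n%:R <= t%:R :> R by rewrite ler_nat.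
have n0 : 0 <= n%:R :> R by [].
rewrite subr_ge0 gerBl mulrA ler_pdivrMr ?divr_ge0 /=; nra.
Qed.

Lemma edge_miss_bound_approx t n : (1 <= t)%N -> (n <= t)%N ->
  1 - attach_ratio * (n%:R / t%:R) <= edge_miss_bound t n
    <= 1 - attach_ratio * (n%:R / t%:R) + attach_error / t%:R.
Proof.
move=> t_gt0 nt; have [one_le_m md_gt0] := (mR_ge1, mdelta_gt0).
have normd_ge0 := normr_ge0 delta; have t_ge1 : 1 <= t%:R :> R by rewrite ler1n.
have n_le_t : n%:R <= t%:R :> R by rewrite ler_nat.
have n0 : 0 <= n%:R :> R by [].
rewrite /edge_miss_bound /attach_min /attach_ratio /attach_error.
set K := 2 * m%:R + `|delta|; have K_gt0 : 0 < K by rewrite /K; lra.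
set D := (2 * m%:R + delta) * t%:R.
have D_gt0 : 0 < D by rewrite /D mulr_gt0; lra.
set N := n%:R * (m%:R + delta).
have N_ge0 : 0 <= N by rewrite /N mulr_ge0; lra.
have N_le_D : N <= D by rewrite /N /D; nra.
have -> : n%:R * ((m%:R + delta) / (D + K)) =
    N / D - N / D * (K / (D + K)) by rewrite /N; field; lra.
have -> : (m%:R + delta) / (2 * m%:R + delta) * (n%:R / t%:R) = N / D.
  by rewrite /D /N; field; lra.
have -> : K / (2 * m%:R + delta) / t%:R = K / D by rewrite /D; field; lra.
have ND_itv : 0 <= N / D <= 1 by rewrite divr_ge0 ?ler_pdivrMr; lra.
have KDK_le : 0 <= K / (D + K) <= K / D.
  by rewrite divr_ge0 ?ler_pM2l ?lef_pV2 ?posrE; lra.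
by nra.
Qed.

(* If all [m] edges of vertex [t+1] miss the [n] uncovered vertices with
   probability [vertex_miss_bound t n], then the left-hand side is [t+1] times
   the expected increment of the uncovered fraction. *)
Lemma miss_drift_le t n : (1 <= t)%N -> (n <= t)%N ->
  2 * vertex_miss_bound t n - 1 - n%:R / t%:R <=
  h m delta (n%:R / t%:R) + 4 * m%:R * attach_error / t.+1%:R.
Proof.
move=> t_gt0 nt; have t_ge1 : 1 <= t%:R :> R by rewrite ler1n.
have /andP[c0 c1] := attach_ratio_itv.
have /andP[approx_ge approx_le] := edge_miss_bound_approx t_gt0 nt.
have /andP[_ miss_le1] := edge_miss_bound_itv nt.
have frac := ratio_nat_itv (R := R) nt.
have pow_diff : vertex_miss_bound t n <=
    (1 - attach_ratio * (n%:R / t%:R)) ^+ m + m%:R * (attach_error / t%:R).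
  rewrite -lerBlDl; apply: le_trans (lerB_exprn m _ approx_ge miss_le1) _.
    by nra.
  by rewrite ler_wpM2l // lerBlDl.
set err : R := m%:R * (attach_error * (2 / t.+1%:R)).
have : m%:R * (attach_error / t%:R) <= err.
  do 2 apply: ler_wpM2l => //; first exact: attach_error_ge0.
  by rewrite ler_pdivlMr ?ltr0n // mulrC ler_pdivrMr -?natr1; lra.
have -> : 4 * m%:R * attach_error / t.+1%:R = 2 * err by rewrite /err; ring.
by rewrite h_attach_ratioE; move: pow_diff; move: err (_ ^+ m) => err q; lra.
Qed.

Definition drift_const : R := 8 * m%:R * attach_error + 4.

Lemma drift_const_ge4 : 4 <= drift_const.
Proof. by rewrite lerDr; apply: mulr_ge0 => //; exact: attach_error_ge0. Qed.

Lemma sqr_excess_drift_le rho t n :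
    0 < rho -> h m delta rho = 0 -> (1 <= t)%N -> (n <= t)%N ->
  vertex_miss_bound t n * excess rho ((n%:R + 1) / t.+1%:R) ^+ 2
    + (1 - vertex_miss_bound t n) * excess rho ((n%:R - 1) / t.+1%:R) ^+ 2
  <= (1 - 2 / t.+1%:R) * excess rho (n%:R / t%:R) ^+ 2
     + drift_const / t.+1%:R ^+ 2.
Proof.
move=> rho0 hrho t_gt0 nt; have t_ge1 : 1 <= t%:R :> R by rewrite ler1n.
have /andP[miss0 miss1] := edge_miss_bound_itv nt.
have frac := ratio_nat_itv (R := R) nt.
have err0 : 0 <= 4 * m%:R * attach_error.
  by apply: mulr_ge0 => //; exact: attach_error_ge0.
have p01 : 0 <= vertex_miss_bound t n <= 1.
  by rewrite exprn_ge0 ?exprn_ile1.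
have inv0 : 0 <= t.+1%:R^-1 :> R by [].
have -> : (n%:R + 1) / t.+1%:R = n%:R / t%:R + (1 - n%:R / t%:R) / t.+1%:R :> R.
  by rewrite -natr1; field; lra.
have -> : (n%:R - 1) / t.+1%:R = n%:R / t%:R - (1 + n%:R / t%:R) / t.+1%:R :> R.
  by rewrite -natr1; field; lra.
have -> : drift_const = 2 * (4 * m%:R * attach_error) + 4.
  by rewrite /drift_const; ring.
rewrite -exprVn; apply: (sqr_excess_step_le (ltW rho0) frac p01 inv0 err0).
move=> rho_le; apply: le_trans (miss_drift_le t_gt0 nt) _; rewrite lerD2r.
by have := h_slope_le (ltW rho0) rho_le (proj2 (andP frac)); rewrite hrho subr0.
Qed.

End DriftFunction.

Section CoveredVertices.
Implicit Types (S : edge_set) (a : {fset nat}) (t u v : nat).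

Lemma covered0 v : covered fset0 v = false.
Proof. by apply/negP => /hasP[a]. Qed.

Lemma covered_fset1U S a v : covered (a |` S)%fset v = (v \in a) || covered S v.
Proof.
apply/hasP/orP => [[b]|[va|/hasP[b bS vb]]].
- rewrite in_fset1U => /orP[/eqP ->|bS] vb; first by left.
  by right; apply/hasP; exists b.
- by exists a; rewrite // in_fset1U eqxx.
- by exists b => //; rewrite in_fset1U bS orbT.
Qed.

Lemma count_iota1S (p : pred nat) t :
  count p (iota 1 t.+1) = (count p (iota 1 t) + p t.+1)%N.
Proof. by rewrite -(addn1 t) iotaD count_cat /= add1n addn0 addn1. Qed.

Lemma num_covered_uncovered S t : (num_covered S t + num_uncovered S t)%N = t.
Proof. by rewrite count_predC size_iota. Qed.

Definition uncovered S t : seq nat := [seq v <- iota 1 t | ~~ covered S v].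

Lemma mem_uncovered S t v :
  (v \in uncovered S t) = (1 <= v <= t)%N && ~~ covered S v.
Proof. by rewrite mem_filter mem_iota add1n ltnS andbC. Qed.

Lemma uncovered_uniq S t : uniq (uncovered S t).
Proof. by rewrite filter_uniq // iota_uniq. Qed.

Lemma size_uncovered S t : size (uncovered S t) = num_uncovered S t.
Proof. by rewrite size_filter. Qed.

Lemma num_uncovered_le S t : (num_uncovered S t <= t)%N.
Proof. by rewrite -{2}(num_covered_uncovered S t) leq_addl. Qed.

Lemma num_uncoveredS S t : ~~ covered S t.+1 ->
  num_uncovered S t.+1 = (num_uncovered S t).+1.
Proof. by move=> St; rewrite /num_uncovered count_iota1S St addn1. Qed.

Lemma num_covered_fset1U S t u : (1 <= u <= t)%N -> ~~ covered S u ->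
  num_covered ([fset u; t.+1] |` S)%fset t.+1 = (num_covered S t).+2.
Proof.
move=> ut uS; rewrite /num_covered count_iota1S covered_fset1U !inE eqxx orbT.
rewrite addn1; congr _.+1.
rewrite (@eq_in_count _ _ (predU (pred1 u) (covered S))) => [|v]; last first.
  rewrite mem_iota => vt.
  by rewrite covered_fset1U !inE (_ : (v == t.+1) = false) ?orbF //; lia.
have := count_predUI (pred1 u) (covered S) (iota 1 t).
rewrite (count_uniq_mem _ (iota_uniq _ _)) mem_iota add1n ltnS ut.
rewrite (@eq_count _ (predI _ _) pred0) ?count_pred0 ?addn0 // => v /=.
by apply/negP => /andP[/eqP -> cu]; rewrite cu in uS.
Qed.

Lemma num_uncovered_fset1U S t u : (1 <= u <= t)%N -> ~~ covered S u ->
  (num_uncovered ([fset u; t.+1] |` S)%fset t.+1).+1 = num_uncovered S t.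
Proof.
move=> ut uS; have := num_covered_fset1U ut uS.
have := num_covered_uncovered S t.
have := num_covered_uncovered ([fset u; t.+1] |` S)%fset t.+1.
lia.
Qed.

Lemma greedy_step_num_uncovered m e t S S' :
  ~~ covered S t.+1 -> greedy_step m e t S S' ->
  let edges_miss := all (fun j => e t.+1 j \notin uncovered S t) (iota 1 m) in
  (num_uncovered S' t.+1 + ~~ edges_miss = num_uncovered S t + edges_miss)%N.
Proof.
move=> St [[u /and3P[ut uS /mapP[j jm uE]] ->]|[no_candidate ->]] edges_miss.
  suff -> : edges_miss = false by rewrite addn1 addn0 num_uncovered_fset1U.
  apply/negbTE; rewrite -has_predC; apply/hasP.
  by exists j; rewrite //= negbK -uE mem_uncovered ut.
suff -> : edges_miss by rewrite addn0 addn1 num_uncoveredS.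
apply/allP => j jm.
apply: contra (no_candidate (e t.+1 j)); rewrite mem_uncovered => /andP[et eS].
by apply/and3P; split=> //; apply/mapP; exists j.
Qed.

Lemma pa_graph_subset m e t : {subset pa_graph m e t 0 <= pa_graph m e t.+1 0}.
Proof.
move=> a; rewrite /pa_graph !cats0 => /allpairsPdep[s [j [sI jI ->]]].
apply/allpairsPdep; exists s, j; split=> //.
by move: sI; rewrite !mem_iota; lia.
Qed.

Lemma is_matching_pa_graphS m e t S : is_matching (pa_graph m e t 0) S ->
  is_matching (pa_graph m e t.+1 0) S.
Proof.
case=> edges disj; split=> // a /edges[u [v [uv aE /orP uvG]]].
exists u, v; split=> //; apply/orP.
by case: uvG => /pa_graph_subset; [left|right].
Qed.

Lemma is_matching_fset1U m e t S u :
  candidate m e t S u -> ~~ covered S t.+1 ->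
  is_matching (pa_graph m e t.+1 0) S ->
  is_matching (pa_graph m e t.+1 0) ([fset u; t.+1] |` S)%fset.
Proof.
move=> /and3P[ut uS /mapP[j jm uE]] tS [edges disj].
have new_disjoint a : a \in S -> [disjoint [fset u; t.+1] & a]%fset.
  move=> aS; apply/fdisjointP => v; rewrite !inE => /orP[/eqP ->|/eqP ->].
    by apply: contra uS => ua; apply/hasP; exists a.
  by apply: contra tS => ta; apply/hasP; exists a.
split=> [a|a b].
  rewrite in_fset1U => /orP[/eqP ->|/edges //].
  exists u, t.+1; split=> //; first by lia.
  apply/orP; right; rewrite /pa_graph cats0; apply/allpairsPdep.
  by exists t.+1, j; split=> //; [rewrite mem_iota; lia|rewrite uE].
rewrite !in_fset1U => /orP[/eqP ->|aS] /orP[/eqP ->|bS]; first by rewrite eqxx.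
- by move=> _; exact: new_disjoint.
- by move=> _; rewrite fdisjoint_sym; exact: new_disjoint.
- exact: disj.
Qed.

End CoveredVertices.

Section GreedyRun.
Variables (m : nat) (e : nat -> nat -> nat) (M : nat -> edge_set).

Definition greedy_run : Prop :=
  M 1%N = fset0 /\
  forall t, (1 <= t)%N -> greedy_step m e t (M t) (M t.+1).

Hypothesis runM : greedy_run.

Lemma greedy_run_ind (Q : nat -> edge_set -> Prop) :
    Q 1%N fset0 ->
    (forall t u, (1 <= t)%N -> Q t (M t) -> candidate m e t (M t) u ->
      Q t.+1 ([fset u; t.+1] |` M t)%fset) ->
    (forall t, (1 <= t)%N -> Q t (M t) -> Q t.+1 (M t)) ->
  forall t, (1 <= t)%N -> Q t (M t).
Proof.
case: runM => M1 Mstep Q1 Qhit Qmiss; elim=> // -[|t] IH _; first by rewrite M1.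
case: (Mstep t.+1 isT) => [[u cu ->]|[_ ->]]; first by apply: Qhit; auto.
by apply: Qmiss; auto.
Qed.

Lemma greedy_run_covered t v : (1 <= t)%N -> covered (M t) v -> (1 <= v <= t)%N.
Proof.
move=> t_gt0; move: t t_gt0 v; apply: (greedy_run_ind
    (Q := fun t S => forall v, covered S v -> (1 <= v <= t)%N)).
- by move=> v; rewrite covered0.
- move=> t u t_gt0 IH /and3P[ut _ _] v.
  by rewrite covered_fset1U !inE => /orP[/orP[/eqP ->|/eqP ->]|/IH]; lia.
- by move=> t t_gt0 IH v /IH; lia.
Qed.

Lemma greedy_run_uncovered_next t : (1 <= t)%N -> ~~ covered (M t) t.+1.
Proof. by move=> t_gt0; apply/negP => /(greedy_run_covered t_gt0); lia. Qed.

Lemma greedy_run_subset t : (1 <= t)%N -> (M t `<=` M t.+1)%fset.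
Proof.
case: runM => _ Mstep t_gt0.
by case: (Mstep t t_gt0) => [[u _ ->]|[_ ->]]; rewrite ?fsubsetUr.
Qed.

Lemma greedy_run_is_matching t : (1 <= t)%N ->
  is_matching (pa_graph m e t 0) (M t).
Proof.
move: t; apply: (greedy_run_ind (Q := fun t => is_matching (pa_graph m e t 0))).
- by split.
- move=> t u t_gt0 /is_matching_pa_graphS matchM cu.
  exact: is_matching_fset1U cu (greedy_run_uncovered_next t_gt0) matchM.
- by move=> t _; exact: is_matching_pa_graphS.
Qed.

Lemma greedy_run_num_covered t : (1 <= t)%N ->
  num_covered (M t) t = (#|` M t|).*2.
Proof.
move: t; apply: (greedy_run_ind
    (Q := fun t S => num_covered S t = (#|` S|).*2)).
- by rewrite cardfs0.
- move=> t u t_gt0 IH /and3P[ut uM _].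
  rewrite (num_covered_fset1U ut uM) IH cardfsU1 -doubleS -add1n.
  suff -> : ([fset u; t.+1]%fset \notin M t) by [].
  apply: contra uM => uM; apply/hasP.
  by exists [fset u; t.+1]%fset; rewrite // !inE eqxx.
- move=> t t_gt0 <-; rewrite /num_covered count_iota1S.
  by rewrite (negbTE (greedy_run_uncovered_next t_gt0)) addn0.
Qed.

Lemma greedy_run_num_uncovered_growth s t : (1 <= s)%N -> (s <= t)%N ->
  (num_uncovered (M t) t <= num_uncovered (M s) s + (t - s))%N.
Proof.
case: runM => _ Mstep s_gt0; elim: t => [|t IH]; first by lia.
rewrite leq_eqVlt => /orP[/eqP <-|]; first by lia.
rewrite ltnS => st; have t_gt0 := leq_trans s_gt0 st; have {}IH := IH st.
have := greedy_step_num_uncovered (greedy_run_uncovered_next t_gt0)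
  (Mstep t t_gt0).
by case: (all _ _) => /=; lia.
Qed.

End GreedyRun.

Section FracExcess.
Context {R : realType}.
Implicit Types (rho : R) (S : edge_set) (t : nat).

Definition frac_excess rho S t : R :=
  excess rho ((num_uncovered S t)%:R / t%:R).

Lemma frac_excess_le1 rho S t : 0 <= rho -> frac_excess rho S t <= 1.
Proof.
move=> rho_ge0.
have /andP[_ frac1] := ratio_nat_itv (R := R) (num_uncovered_le S t).
by rewrite ge_max ler01 lerBlDr (le_trans frac1) // lerDl.
Qed.

Lemma num_covered_ge rho S t : rho < 1 -> (1 <= t)%N ->
  (1 - frac_excess rho S t / (1 - rho)) * ((1 - rho) * t%:R)
    <= (num_covered S t)%:R.
Proof.
move=> rho1 t_gt0; have t_ge1 : 1 <= t%:R :> R by rewrite ler1n.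
have -> : (1 - frac_excess rho S t / (1 - rho)) * ((1 - rho) * t%:R) =
    (1 - rho - frac_excess rho S t) * t%:R by field; lra.
have -> : (num_covered S t)%:R = t%:R - (num_uncovered S t)%:R :> R.
  by apply/eqP; rewrite eq_sym subr_eq -natrD num_covered_uncovered.
have -> : t%:R - (num_uncovered S t)%:R =
    (1 - (num_uncovered S t)%:R / t%:R) * t%:R :> R by field; lra.
have := excess_ge rho ((num_uncovered S t)%:R / t%:R).
by rewrite -/(frac_excess rho S t) => exc; rewrite ler_wpM2r //; lra.
Qed.

Lemma greedy_run_frac_excess_growth m e M rho s t :
  greedy_run m e M -> (1 <= s)%N -> (s <= t)%N ->
  frac_excess rho (M t) t <= frac_excess rho (M s) s + (t - s)%:R / s%:R.
Proof.
move=> runM s_gt0 st; have sR_gt0 : 0 < s%:R :> R by rewrite ltr0n.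
apply: le_trans (excess_addr_le _ _ _); last by rewrite divr_ge0.
apply: excess_homo; rewrite -mulrDl -natrD.
have growth := greedy_run_num_uncovered_growth runM s_gt0 st.
apply: (@le_trans _ _ ((num_uncovered (M t) t)%:R / s%:R)).
  by rewrite ler_wpM2l // lef_pV2 ?posrE ?ltr0n ?ler_nat // (leq_trans s_gt0).
by rewrite ler_wpM2r ?invr_ge0 ?ler_nat // ltW.
Qed.

End FracExcess.

Lemma greedy_matching_run d (T : measurableType d) m (F : nat -> set (set T))
    (W : nat -> nat -> T -> nat) (M : nat -> T -> edge_set) :
  greedy_matching m F W M ->
  forall w, greedy_run m (fun s j => W s j w) (M^~ w).
Proof. by case=> _ M1 Mstep w; split; [exact: M1|exact: Mstep]. Qed.

Definition edge_slots (m t k : nat) : seq (nat * nat) :=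
  [seq (s, j) | s <- iota 1 t, j <- iota 1 m]
    ++ [seq (t.+1, j) | j <- iota 1 k].

Lemma pa_graphE m e t k :
  pa_graph m e t k = [seq (p.1, e p.1 p.2) | p <- edge_slots m t k].
Proof. by rewrite map_cat map_allpairs -map_comp. Qed.

Lemma edge_slots_bounds m t k p : (k <= m)%N -> p \in edge_slots m t k ->
  (1 <= p.1)%N && (1 <= p.2 <= m)%N.
Proof.
move=> km; rewrite mem_cat => /orP[/allpairsPdep[s [j [sI jI ->]]]|].
  by move: sI jI; rewrite !mem_iota /=; lia.
by move=> /mapP[j jI ->]; move: jI; rewrite mem_iota /=; lia.
Qed.

Lemma pa_graph_last_edges m e e' t k : pa_graph m e t k = pa_graph m e' t k ->
  {in iota 1 k, e t.+1 =1 e' t.+1}.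
Proof.
rewrite !pa_graphE => /eq_in_map eq_e j jk.
have /eq_e[] // : (t.+1, j) \in edge_slots m t k.
by rewrite mem_cat map_f ?orbT.
Qed.

Lemma deg_pa_graph_ge m e t k x : (1 <= x <= t)%N ->
  (m <= deg (pa_graph m e t k) x)%N.
Proof.
move=> xt; rewrite /deg /pa_graph big_cat big_allpairs_dep /=.
apply: leq_trans (leq_addr _ _).
rewrite (bigD1_seq x) ?iota_uniq ?mem_iota //=; apply: leq_trans (leq_addr _ _).
rewrite -[leqLHS](size_iota 1) -sum1_size; apply: leq_sum => j _.
by rewrite eqxx.
Qed.

Lemma pa_prob_ge (R : realType) m (delta : R) g t i x :
    - m%:R < delta -> (1 <= i <= m)%N -> (1 <= x <= t)%N -> (m <= deg g x)%N ->
  attach_min m delta t <= pa_prob m delta g t i x.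
Proof.
move=> delta_gt /andP[i1 im] xt dx; rewrite /pa_prob xt.
have i_ge1 : 1 <= i%:R :> R by rewrite ler1n.
have i_le_m : i%:R <= m%:R :> R by rewrite ler_nat.
have t_ge1 : 1 <= t%:R :> R by rewrite ler1n; lia.
have deg_ge_m : m%:R <= (deg g x)%:R :> R by rewrite ler_nat.
have normd_ge0 : 0 <= `|delta| := normr_ge0 delta.
have delta_le_norm := ler_norm delta.
pose q : R := i%:R / m%:R.
have q01 : 0 <= q <= 1 by rewrite /q divr_ge0 ?ler_pdivrMr; lra.
have iq : i%:R = q * m%:R by rewrite /q divfK //; lra.
have -> : i%:R * delta / m%:R = q * delta by rewrite /q mulrAC.
have qu : q * delta <= `|delta| by nra.
have ql : - i%:R <= q * delta by rewrite iq; nra.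
have D_gt0 : 0 < (2 * m%:R + delta) * t%:R by rewrite mulr_gt0; lra.
apply: ler_pM => //; [lra|by rewrite invr_ge0; lra|lra|].
by rewrite lef_pV2 ?posrE; lra.
Qed.

Lemma uniq_range_size_le (U : seq nat) t :
  uniq U -> {in U, forall x, (1 <= x <= t)%N} -> (size U <= t)%N.
Proof.
move=> uU Ut; rewrite -[leqRHS](size_iota 1); apply: uniq_leq_size => // x /Ut.
by rewrite mem_iota add1n ltnS.
Qed.

Section MissProbability.
Context {R : realType} {d : measure_display} {T : measurableType d}.
Variables (P : probability T R) (m : nat) (delta : R).
Variables (F : nat -> set (set T)) (W : nat -> nat -> T -> nat).
Hypothesis pref_attachW : pref_attachment P m delta F W.
Implicit Types (A : set T) (U : seq nat) (g : multigraph).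

Let G t k w := pa_graph m (fun s j => W s j w) t k.

Definition edges_miss U t k : set T :=
  [set w | all (fun j => W t.+1 j w \notin U) (iota 1 k)].

Lemma edges_missS U t k :
  edges_miss U t k.+1 = edges_miss U t k `&` [set w | W t.+1 k.+1 w \notin U].
Proof.
rewrite /edges_miss -(addn1 k) iotaD add1n addn1 cats1.
apply/seteqP; split=> w /=; rewrite all_rcons; first by case/andP.
by case=> -> ->.
Qed.

Lemma edges_miss_pa_graph U t k w w' : G t k w = G t k w' ->
  edges_miss U t k w -> edges_miss U t k w'.
Proof.
move=> /pa_graph_last_edges eqW /allP missw; apply/allP => j jk.
by rewrite -eqW //; exact: missw.
Qed.

Lemma filtration_measurable t A : F t A -> measurable A.
Proof. by case: pref_attachW => -[_ Fm _] _ _ _; exact: Fm. Qed.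

Lemma measurable_fibers_edge s j : (1 <= s)%N -> (1 <= j <= m)%N ->
  measurable_fibers (W s j).
Proof.
case: pref_attachW => _ FW _ _ s_gt0 jm y.
by apply: (@filtration_measurable s); apply: FW; rewrite ?s_gt0 ?leqnn.
Qed.

Lemma measurable_fibers_pa_graph t k : (k <= m)%N -> measurable_fibers (G t k).
Proof.
move=> km; rewrite /G; under eq_fun do rewrite pa_graphE.
apply: measurable_fibers_map => p /(edge_slots_bounds km)/andP[s_gt0 jm] [s n].
have [<-|sp] := pselect (p.1 = s); last first.
  by rewrite (_ : mkset _ = set0) //; apply/seteqP; split=> // w [].
rewrite (_ : mkset _ = [set w | W p.1 p.2 w = n]).
  exact: measurable_fibers_edge.
by apply/seteqP; split=> w /= [->].
Qed.

Lemma measurable_edges_miss U t k : (k <= m)%N -> measurable (edges_miss U t k).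
Proof.
move=> km; rewrite (_ : edges_miss U t k =
    (fun w => [seq W t.+1 j w | j <- iota 1 k]) @^-1`
    [set s | all (fun x => x \notin U) s]); last first.
  by apply/seteqP; split=> w; rewrite /edges_miss /preimage /= all_map.
apply: measurable_fibers_preimage; apply: measurable_fibers_map => j.
by rewrite mem_iota => jk; apply: measurable_fibers_edge => //; lia.
Qed.

Lemma hit_probability t i A g U :
  (1 <= t)%N -> (1 <= i <= m)%N -> F t A -> uniq U ->
  P (A `&` [set w | G t i.-1 w = g] `&` [set w | W t.+1 i w \in U]) =
  (P (A `&` [set w | G t i.-1 w = g])
    * (\sum_(x <- U) pa_prob m delta g t i x)%:E)%E.
Proof.
move=> t_gt0 im FA uU; set B := A `&` _.
have mB : measurable B.
  apply: measurableI; first exact: filtration_measurable FA.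
  by apply: measurable_fibers_pa_graph; lia.
have -> : B `&` [set w | W t.+1 i w \in U] =
    \bigcup_(x in [set` U]) (B `&` [set w | W t.+1 i w = x]).
  by rewrite -setI_bigcupr; congr (_ `&` _); apply/seteqP; split=> w /=;
    [exists (W t.+1 i w)|case=> x xU ->].
rewrite measure_fin_bigcup //=; last 2 first.
- by move=> x y _ _ [w [[_ <-] [_ <-]]].
- by move=> x _; apply: measurableI => //; exact: measurable_fibers_edge.
rewrite -fsbig_seq //= -sumEFin fin_num_sume_distrr ?fin_num_measure //.
by apply: eq_bigr => x _; case: pref_attachW => _ _ _; exact.
Qed.

Hypothesis delta_gt : - m%:R < delta.

Lemma edge_miss_probability t k A g U (B := A `&` [set w | G t k w = g]) :
    (1 <= t)%N -> (k < m)%N -> F t A -> uniq U ->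
    {in U, forall x, (1 <= x <= t)%N && (m <= deg g x)%N} ->
  (P (B `&` [set w | W t.+1 k.+1 w \notin U]) <=
    (edge_miss_bound m delta t (size U))%:E * P B)%E.
Proof.
move=> t_gt0 km FA uU Ug.
have hit := @hit_probability t k.+1 A g U t_gt0 km FA uU; rewrite -/B in hit.
have mB : measurable B.
  apply: measurableI; first exact: filtration_measurable FA.
  by apply: measurable_fibers_pa_graph; exact: ltnW.
have mhit : measurable (B `&` [set w | W t.+1 k.+1 w \in U]).
  apply: measurableI => //.
  apply: (measurable_fibers_preimage [set y | y \in U]).
  exact: measurable_fibers_edge.
have -> : B `&` [set w | W t.+1 k.+1 w \notin U] =
    B `\` (B `&` [set w | W t.+1 k.+1 w \in U]).
  rewrite setDIr setDv set0U setDE; congr (_ `&` _).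
  by apply/seteqP; split=> w /= /negP.
rewrite measureD //; last by rewrite ltey_eq fin_num_measure.
have PB : P B \is a fin_num by exact: fin_num_measure.
rewrite setIA setIid [X in (_ - X)%E]hit -[X in (X - _)%E](fineK PB).
rewrite -[X in (_ - X * _)%E](fineK PB) -[X in (_ <= _ * X)%E](fineK PB).
rewrite -!EFinM -EFinB lee_fin -[X in X - _]mulr1 -mulrBr mulrC.
apply: ler_wpM2r; first by rewrite fine_ge0.
rewrite lerB // mulr_natl -iter_addr_0 -count_predT -big_const_seq.
rewrite big_seq [leRHS]big_seq; apply: ler_sum => x /Ug/andP[xt dx].
exact: pa_prob_ge.
Qed.

Hypothesis m_ge1 : (1 <= m)%N.

(* The graph just before the [k+1]-st edge determines [edges_miss U t k], so it
   is enough to condition on this graph. *)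
Lemma edges_missS_probability t k A U :
    (1 <= t)%N -> (k < m)%N -> F t A -> uniq U ->
    {in U, forall x, (1 <= x <= t)%N} ->
  (P (A `&` edges_miss U t k.+1) <=
    (edge_miss_bound m delta t (size U))%:E * P (A `&` edges_miss U t k))%E.
Proof.
move=> t_gt0 km FA uU Ut; have mA := filtration_measurable FA.
have /andP[miss0 _] :=
  edge_miss_bound_itv m_ge1 delta_gt (uniq_range_size_le uU Ut).
apply: (le_measure_fibers (@measurable_fibers_pa_graph t k (ltnW km))) => //.
- by apply: measurableI => //; exact: measurable_edges_miss.
- by apply: measurableI => //; apply: measurable_edges_miss; exact: ltnW.
move=> g; rewrite edges_missS setIA (setIAC (_ `&` _)).
rewrite !(setIAC A (edges_miss U t k)).
have [->|/set0P[w [[Aw Gw] missw]]] := eqVneq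
    (A `&` [set w | G t k w = g] `&` edges_miss U t k) set0.
  by rewrite set0I measure0 mule0.
have /setIidl -> : A `&` [set w | G t k w = g] `<=` edges_miss U t k.
  by move=> w' [_ Gw']; apply: edges_miss_pa_graph missw; rewrite Gw Gw'.
apply: edge_miss_probability => // x xU; rewrite Ut //= -Gw.
by apply: deg_pa_graph_ge; exact: Ut.
Qed.

Lemma vertex_miss_probability t A U :
    (1 <= t)%N -> F t A -> uniq U -> {in U, forall x, (1 <= x <= t)%N} ->
  (P (A `&` edges_miss U t m) <=
    (vertex_miss_bound m delta t (size U))%:E * P A)%E.
Proof.
move=> t_gt0 FA uU Ut; have mA := filtration_measurable FA.
have /andP[miss0 _] :=
  edge_miss_bound_itv m_ge1 delta_gt (uniq_range_size_le uU Ut).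
suff miss_first k : (k <= m)%N -> (P (A `&` edges_miss U t k) <=
    (edge_miss_bound m delta t (size U) ^+ k)%:E * P A)%E by exact: miss_first.
elim: k => [_|k IH km].
  rewrite mul1e le_measure ?inE //.
  by apply: measurableI => //; exact: measurable_edges_miss.
apply: le_trans (edges_missS_probability t_gt0 km FA uU Ut) _.
by rewrite exprS EFinM -muleA lee_wpmul2l ?lee_fin // IH // ltnW.
Qed.

End MissProbability.

Section GreedyExcess.
Context {R : realType} {d : measure_display} {T : measurableType d}.
Variables (P : probability T R) (m : nat) (delta rho : R).
Variables (F : nat -> set (set T)) (W : nat -> nat -> T -> nat).
Variable M : nat -> T -> edge_set.
Hypothesis pref_attachW : pref_attachment P m delta F W.
Hypothesis greedyM : greedy_matching m F W M.

Let Y t w : R := frac_excess rho (M t w) t.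

Lemma measurable_fibers_matching t : (1 <= t)%N -> measurable_fibers (M t).
Proof.
case: greedyM => FM _ _ t_gt0 S.
exact: (filtration_measurable pref_attachW (FM t S t_gt0)).
Qed.

Lemma measurable_fun_matching t (g : edge_set -> R) : (1 <= t)%N ->
  measurable_fun setT (fun w => g (M t w)).
Proof.
move=> t_gt0.
exact: (measurable_fun_fibers g (measurable_fibers_matching t_gt0)).
Qed.

Lemma measurable_sqr_excess t : (1 <= t)%N ->
  measurable_fun setT (fun w => Y t w ^+ 2).
Proof.
exact: (measurable_fun_matching (fun S => frac_excess rho S t ^+ 2)).
Qed.

Lemma num_uncovered_next t w : (1 <= t)%N ->
  [/\ edges_miss W (uncovered (M t w) t) t m w ->
        num_uncovered (M t.+1 w) t.+1 = (num_uncovered (M t w) t).+1 &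
      ~ edges_miss W (uncovered (M t w) t) t m w ->
        (num_uncovered (M t.+1 w) t.+1).+1 = num_uncovered (M t w) t].
Proof.
move=> t_gt0; have runM := greedy_matching_run greedyM w.
have [_ /(_ t t_gt0) Mstep] := runM.
have := greedy_step_num_uncovered (greedy_run_uncovered_next runM t_gt0) Mstep.
by rewrite /edges_miss /=; case: (all _ _) => /= next; split=> // _; lia.
Qed.

Hypotheses (m_ge1 : (1 <= m)%N) (delta_gt : - m%:R < delta).
Hypotheses (rho_gt0 : 0 < rho) (h_rho : h m delta rho = 0).

Lemma conditional_second_moment_le t S : (1 <= t)%N ->
  (\int[P]_(w in [set w | M t w = S]) (Y t.+1 w ^+ 2)%:E <=
   ((1 - 2 / t.+1%:R) * frac_excess rho S t ^+ 2
      + drift_const m delta / t.+1%:R ^+ 2)%:E * P [set w | M t w = S])%E.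
Proof.
move=> t_gt0; set A := [set w | _]; set n := num_uncovered S t.
have nt : (n <= t)%N := num_uncovered_le S t.
have FA : F t A by case: greedyM => FM _ _; exact: FM.
have U_range : {in uncovered S t, forall x, (1 <= x <= t)%N}.
  by move=> x; rewrite mem_uncovered => /andP[].
have missP := vertex_miss_probability pref_attachW delta_gt m_ge1 t_gt0 FA
  (uncovered_uniq S t) U_range.
rewrite size_uncovered -/n in missP.
have mono : excess rho ((n%:R - 1) / t.+1%:R) <=
    excess rho ((n%:R + 1) / t.+1%:R).
  by apply: excess_homo; rewrite ler_wpM2r ?invr_ge0 //; lra.
apply: (@le_trans _ _ ((vertex_miss_bound m delta t n *
      excess rho ((n%:R + 1) / t.+1%:R) ^+ 2 +
    (1 - vertex_miss_bound m delta t n) *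
      excess rho ((n%:R - 1) / t.+1%:R) ^+ 2)%:E * P A)%E); last first.
  by rewrite lee_wpmul2r // lee_fin; exact: sqr_excess_drift_le.
apply: (ge0_integral_le_two_values _ _ _ _ _ _ _ _ missP).
- exact: measurable_fibers_matching.
- exact: (measurable_edges_miss pref_attachW _ _ (leqnn m)).
- by apply: measurable_funTS; exact: measurable_sqr_excess.
- by move=> w; rewrite sqr_ge0.
- by rewrite sqr_ge0.
- by rewrite lerXn2r ?nnegrE ?excess_ge0.
- move=> w Aw missw; have [+ _] := num_uncovered_next w t_gt0.
  by rewrite (Aw : M t w = S) /Y /frac_excess natr1 => ->.
- move=> w Aw hitw; have [_ +] := num_uncovered_next w t_gt0.
  rewrite (Aw : M t w = S) -/n => /(_ hitw) <-.
  by rewrite /Y /frac_excess -[X in X - 1]natr1 addrK.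
Qed.

Lemma second_moment_recursion t : (1 <= t)%N ->
  (\int[P]_w (Y t.+1 w ^+ 2)%:E <=
   (1 - 2 / t.+1%:R)%:E * \int[P]_w (Y t w ^+ 2)%:E
     + (drift_const m delta / t.+1%:R ^+ 2)%:E)%E.
Proof.
move=> t_gt0; have t_ge1 : 2 <= t.+1%:R :> R by rewrite ler_nat.
have coef0 : 0 <= 1 - 2 / t.+1%:R :> R by rewrite subr_ge0 ler_pdivrMr; lra.
have const0 : 0 <= drift_const m delta / t.+1%:R ^+ 2.
  by rewrite divr_ge0 ?sqr_ge0 // (le_trans _ (drift_const_ge4 m_ge1 delta_gt)).
rewrite -ge0_integral_affine //; last 2 first.
- exact: measurable_sqr_excess.
- by move=> w; rewrite sqr_ge0.
apply: (ge0_le_integral_fibers (measurable_fibers_matching t_gt0)).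
- by apply/measurable_EFinP; exact: measurable_sqr_excess.
- apply/measurable_EFinP.
  exact: (measurable_fun_matching (fun S => _ * frac_excess rho S t ^+ 2 + _)).
- by move=> w; rewrite lee_fin sqr_ge0.
- by move=> w; rewrite lee_fin addr_ge0 // mulr_ge0 ?sqr_ge0.
move=> S; apply: le_trans (conditional_second_moment_le S t_gt0) _.
have mS := measurable_fibers_matching t_gt0 S.
rewrite -integral_cst //; apply: ge0_le_integral => //.
- by move=> w _; rewrite lee_fin addr_ge0 // mulr_ge0 ?sqr_ge0.
- apply: measurable_funTS; apply/measurable_EFinP.
  exact: (measurable_fun_matching (fun S => _ * frac_excess rho S t ^+ 2 + _)).
- by move=> w Mw; rewrite /Y (Mw : M t w = S).
Qed.

Lemma second_moment_le t : (1 <= t)%N ->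
  (\int[P]_w (Y t w ^+ 2)%:E <= (drift_const m delta / t%:R)%:E)%E.
Proof.
have const_ge4 := drift_const_ge4 m_ge1 delta_gt; elim: t => // -[|t] IH _.
  apply: (@le_trans _ _ (\int[P]_w (cst 1%:E w))%E).
    apply: ge0_le_integral => //.
    - by move=> w _; rewrite lee_fin sqr_ge0.
    - by apply/measurable_EFinP; exact: measurable_sqr_excess.
    by move=> w _; rewrite lee_fin exprn_ile1 ?excess_ge0 ?frac_excess_le1 ?ltW.
  rewrite integral_cst // [X in (_ * X)%E]probability_setT mul1e divr1 lee_fin.
  by lra.
apply: le_trans (second_moment_recursion _) _ => //.
have t_ge1 : 1 <= t.+1%:R :> R by rewrite ler1n.
have coef0 : 0 <= 1 - 2 / t.+2%:R :> R.
  by rewrite subr_ge0 ler_pdivrMr -?natr1; lra.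
apply: (@le_trans _ _ ((1 - 2 / t.+2%:R)%:E * (drift_const m delta / t.+1%:R)%:E
    + (drift_const m delta / t.+2%:R ^+ 2)%:E)%E).
  by apply: leeD2r; apply: lee_wpmul2l; [rewrite lee_fin|exact: IH].
rewrite -EFinM -EFinD lee_fin -(natr1 t.+1); apply: inv_recursion_step => //.
exact: le_trans const_ge4.
Qed.

Lemma weighted_second_moment_le alpha k :
  (\int[P]_w ((k.+1%:R `^ (3 * alpha) *
     Y (k.+1 ^ 3) w) ^+ 2)%:E <=
   (drift_const m delta * riemannR (3 - 6 * alpha) k)%:E)%E.
Proof.
have k3 : (1 <= k.+1 ^ 3)%N by rewrite expn_gt0.
under eq_integral do rewrite exprMn EFinM.
rewrite ge0_integralZl ?lee_fin ?sqr_ge0 //; last 2 first.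
- by apply/measurable_EFinP; exact: measurable_sqr_excess.
- by move=> w _; rewrite lee_fin sqr_ge0.
apply: le_trans (lee_wpmul2l _ (second_moment_le k3)) _.
  by rewrite lee_fin sqr_ge0.
rewrite -EFinM lee_fin mulrCA /riemannR -powRN opprB.
rewrite powRB ?pnatr_eq0 ?implybT //.
have -> : (k.+1%:R `^ (3 * alpha)) ^+ 2 = k.+1%:R `^ (6 * alpha) :> R.
  by rewrite -powR_mulrn ?powR_ge0 // -powRrM; congr (_ `^ _); ring.
by rewrite natrX powR_mulrn.
Qed.

Lemma ae_cvg_frac_excess_cubes alpha : alpha < 1 / 3 ->
  {ae P, forall w, (fun k => k%:R `^ (3 * alpha) *
    Y (k ^ 3) w) @ \oo --> (0 : R)}.
Proof.
move=> alpha_lt; pose f k w : R := k.+1%:R `^ (3 * alpha) *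
  Y (k.+1 ^ 3) w.
have mf k : measurable_fun setT (fun w => f k w ^+ 2).
  have k3 : (1 <= k.+1 ^ 3)%N by rewrite expn_gt0.
  exact: (measurable_fun_matching (fun S => (_ * frac_excess rho S _) ^+ 2) k3).
have f2_ge0 k w : 0 <= f k w ^+ 2 by exact: sqr_ge0.
have sum_fin : (\sum_(0 <= k <oo) \int[P]_w (f k w ^+ 2)%:E < +oo)%E.
  apply: le_lt_trans (lee_nneseries _ _) (nneseries_lt_pinfty _).
  - by move=> k _ _; apply: integral_ge0 => w _; rewrite lee_fin.
  - by move=> k _; exact: weighted_second_moment_le.
  - by apply: is_cvg_seriesZ; apply: is_cvg_series_riemannR; lra.
apply: filterS (ae_cvg0_summable mf f2_ge0 sum_fin) => w fw.
by rewrite -cvg_shiftS; exact: cvg0_sqr fw.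
Qed.

Lemma ae_cvg_frac_excess alpha : alpha < 1 / 3 ->
  {ae P, forall w, (fun t => t%:R `^ alpha * Y t w) @ \oo
    --> (0 : R)}.
Proof.
move=> alpha_lt; apply: filterS (ae_cvg_frac_excess_cubes alpha_lt) => w.
apply: (cvg_cube_interpolation (c := 7) alpha_lt) => [n|k n k_gt0 kn nk].
  exact: excess_ge0.
apply: le_trans (greedy_run_frac_excess_growth rho
  (greedy_matching_run greedyM w) _ kn) _; first by rewrite expn_gt0 k_gt0.
by rewrite lerD2l; exact: cube_gap_le.
Qed.

End GreedyExcess.

Theorem theorem2p5 (R : realType) (m : nat) (delta : R)
    (m_ge1 : (1 <= m)%N) (delta_gt : - m%:R < delta) :
  exists2 rho : R,
    unique (fun z : R => 0 < z < 1 /\ h m delta z = 0) rho &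
    forall (d : measure_display) (T : measurableType d) (P : probability T R)
      (F : nat -> set (set T)) (W : nat -> nat -> T -> nat)
      (M : nat -> T -> edge_set),
      pref_attachment P m delta F W ->
      greedy_matching m F W M ->
      (forall alpha : R, alpha < 1 / 3 ->
        {ae P, forall w : T,
          (fun t : nat => t%:R `^ alpha *
             Num.max 0 ((num_uncovered (M t w) t)%:R / t%:R - rho)) @ \oo
          --> (0 : R)}) /\
      {ae P, forall w : T,
        [/\ forall t : nat, (1 <= t)%N ->
              is_matching (pa_graph m (fun s j => W s j w) t 0) (M t w),
            forall t : nat, (1 <= t)%N -> (M t w `<=` M t.+1 w)%fset &
            exists eps : nat -> R,
              (eps @ \oo --> (0 : R)) /\
              forall t : nat, (1 <= t)%N ->
                (1 - eps t) * ((1 - rho) * t%:R / 2) <= (#|` M t w|)%:R /\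
                (1 - eps t) * ((1 - rho) * t%:R) <= (num_covered (M t w) t)%:R]}.
Proof.
have [rho rhoU] := h_unique_root m_ge1 delta_gt; exists rho => //.
move=> d T P F W M pref_attachW greedyM.
have [[/andP[rho_gt0 rho_lt1] h_rho] _] := rhoU.
have excess0 := ae_cvg_frac_excess pref_attachW greedyM m_ge1 delta_gt
  rho_gt0 h_rho.
split=> [alpha|]; first exact: excess0.
have : (0 : R) < 1 / 3 by lra.
move=> /excess0; apply: filterS => w; under eq_fun do rewrite powRr0 mul1r.
move=> excess_w; have runM := greedy_matching_run greedyM w; split.
- exact: greedy_run_is_matching runM.
- exact: greedy_run_subset runM.
exists (fun t => frac_excess rho (M t w) t / (1 - rho)); split.
  by rewrite -(mul0r (1 - rho)^-1); apply: cvgM => //; exact: cvg_cst.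
move=> t t_gt0; have covered_ge := num_covered_ge (M t w) rho_lt1 t_gt0.
split=> //; rewrite mulrA ler_pdivrMr //; apply: le_trans covered_ge _.
by rewrite (greedy_run_num_covered runM) // -muln2 natrM.
Qed.
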